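(* Let $I\subseteq\mathbb{R}$ be an interval with interior $I^{\circ}$, and let $f:I\to\mathbb{R}$ be a twice differentiable function on $I^{\circ}$ such that $f''\in L[a,b]$, where $a,b\in I$ and $m\in(0,1]$ with $0\le a<mb$. Then for all $x\in[a,mb]$, $\lambda\in[0,1]$ and $\kappa>0$, $$I_f(x,\lambda,\kappa;a,mb)=\frac{(x-a)^{\kappa+2}}{(\kappa+1)(mb-a)}\int_0^1 t\big((\kappa+1)\lambda-t^{\kappa}\big)f''\big(tx+(1-t)a\big)\,dt+\frac{(mb-x)^{\kappa+2}}{(\kappa+1)(mb-a)}\int_0^1 t\big((\kappa+1)\lambda-t^{\kappa}\big)f''\big(tx+m(1-t)b\big)\,dt .$$
   Context: $L[a,b]$ is the space of Lebesgue integrable functions on $[a,b]$. For $\kappa>0$ the Riemann–Liouville integrals are $J_{u^+}^{\kappa}f(v)=\frac{1}{\Gamma(\kappa)}\int_u^v (v-t)^{\kappa-1}f(t)\,dt$ for $v>u$ and $J_{u^-}^{\kappa}f(v)=\frac{1}{\Gamma(\kappa)}\int_v^u (t-v)^{\kappa-1}f(t)\,dt$ for $v<u$ (both taken to be $0$ when $u=v$), where $\Gamma$ is the Gamma function. Define $$I_f(x,\lambda,\kappa;a,mb)=(1-\lambda)\frac{(x-a)^{\kappa}+(mb-x)^{\kappa}}{mb-a}f(x)+\lambda\,\frac{(x-a)^{\kappa}f(a)+(mb-x)^{\kappa}f(mb)}{mb-a}+\Big(\frac1{\kappa+1}-\lambda\Big)\frac{(mb-x)^{\kappa+1}-(x-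a)^{\kappa+1}}{mb-a}f'(x)-\frac{\Gamma(\kappa+1)}{mb-a}\big[J_{x^-}^{\kappa}f(a)+J_{x^+}^{\kappa}f(mb)\big].$$
   Formalization: The formal theorem additionally assumes f continuous on [a,mb] (one-sided at the ends), without which the claim fails when a or b is an endpoint of I and f jumps there; f'(x) at an endpoint of I is read as the one-sided derivative. *)

(* Defs.v *)
From HB Require Import structures.
From mathcomp Require Import all_boot all_order all_algebra.
From mathcomp Require Import all_classical all_reals all_analysis.

Set Implicit Arguments.
Unset Strict Implicit.
Unset Printing Implicit Defensive.

Import Order.TTheory GRing.Theory Num.Theory.
Import numFieldNormedType.Exports.

Local Open Scope ring_scope.
Local Open Scope classical_set_scope.

(* Meant for 0 < s only, where the integral converges. *)
Definition Gamma (R : realType) (s : R) : R :=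
  \int[@lebesgue_measure R]_(t in `]0, +oo[) (t `^ (s - 1) * expR (- t)).

(* J_{u^+}^k f(v), for u <= v; it is 0 when u = v, the domain being a null
   set. *)
Definition RL_plus (R : realType) (k : R) (f : R -> R) (u v : R) : R :=
  (Gamma k)^-1 *
  \int[@lebesgue_measure R]_(t in `[u, v]) ((v - t) `^ (k - 1) * f t).

(* J_{u^-}^k f(v), for v <= u; it is 0 when u = v. *)
Definition RL_minus (R : realType) (k : R) (f : R -> R) (u v : R) : R :=
  (Gamma k)^-1 *
  \int[@lebesgue_measure R]_(t in `[v, u]) ((t - v) `^ (k - 1) * f t).

(* The derivative at x of the restriction of f to I: it is f^`() x when x is
   interior to I (derive1_inE), and the one-sided derivative when x is an
   endpoint belonging to a nondegenerate interval I. *)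
Definition derive1_in (R : realType) (I : set R) (f : R -> R) (x : R) : R :=
  lim ((fun y => (f y - f x) / (y - x)) @ within I x^').

Lemma derive1_inE (R : realType) (I : set R) (f : R -> R) (x : R) :
  I° x -> derivable f x 1 -> derive1_in I f x = f^`() x.
Proof.
move=> Ix df; rewrite /derive1_in.
have -> : within I x^' = x^'.
  rewrite eqEsubset; split => A.
    rewrite /within /= => h; near=> y.
    have Iy : I y by near: y; exact: nbhs_dnbhs.
    by move: Iy; near: y.
  by move=> h; rewrite /within /=; near=> y => _; near: y.
have sub_cvg : (y - x) @[y --> x^'] --> 0^'.
  move=> A; rewrite /dnbhs /within /= => A0.
  have c : (y - x) @[y --> x] --> 0.
    by rewrite -(subrr x); apply: cvgB; [exact: cvg_id | exact: cvg_cst].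
  have := c _ A0; rewrite /nbhs /= => cA.
  apply: (@filterS _ (nbhs x)) cA => y /= h yx.
  by apply: h; rewrite subr_eq0.
have := cvg_comp _ _ sub_cvg df.
rewrite derive1E /derive => dx.
have -> : (fun y => (f y - f x) / (y - x)) =
    (fun h => h^-1 *: ((f \o shift x) (h *: 1) - f x)) \o (fun y => y - x).
  by apply/funext => y /=; rewrite -[_%:A]/(_ * 1) mulr1 subrK [LHS]mulrC.
exact: cvg_lim dx.
Unshelve. all: by end_near. Qed.

(* I_f(x, l, k; a, c), where c stands for m b. The set I is the domain of f. *)
Definition I_fun (R : realType) (I : set R) (f : R -> R) (x l k a c : R) : R :=
  (1 - l) * (((x - a) `^ k + (c - x) `^ k) / (c - a)) * f x
  + l * (((x - a) `^ k * f a + (c - x) `^ k * f c) / (c - a))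
  + ((k + 1)^-1 - l) * (((c - x) `^ (k + 1) - (x - a) `^ (k + 1)) / (c - a))
    * derive1_in I f x
  - Gamma (k + 1) / (c - a) * (RL_minus k f x a + RL_plus k f x c).

(* Main.v *)
Require Import Defs.
From HB Require Import structures.
From mathcomp Require Import all_boot all_order all_algebra.
From mathcomp Require Import all_classical all_reals all_analysis.
From mathcomp Require Import measurable_realfun ring lra.

Set Implicit Arguments.
Unset Strict Implicit.
Unset Printing Implicit Defensive.

Import Order.TTheory GRing.Theory Num.Theory.
Import numFieldNormedType.Exports.

Local Open Scope ring_scope.
Local Open Scope classical_set_scope.

(* Fix an endpoint u in {a, m b} and put d = x - u, phi t = f (u + t d) and
   w t = t ((k + 1) l - t^k). On ]0, 1[,
     (w phi' - (k + 1) (l - t^k) phi)' = w phi'' + (k + 1) k t^(k-1) phi,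
   so integrating over [0, 1] expresses \int w phi'' through phi 0, phi 1,
   phi'(1-) and \int t^(k-1) phi, which is a Riemann-Liouville integral after
   rescaling. Summing over the two endpoints and using
   Gamma (k + 1) = k Gamma k gives the identity.

   As f'' is only Lebesgue integrable, this relies on the fundamental theorem
   of calculus for everywhere differentiable functions with integrable
   derivative, proved with a Vitali-Caratheodory majorant of the derivative.
   The same theorem gives phi' a limit at 1, hence f a one-sided derivative
   at x when x is an endpoint of I. *)

(** * Everywhere differentiable functions with integrable derivative *)

Lemma lebesgue_measure_segment (R : realType) (a b : R) : a < b ->
  @lebesgue_measure R `[a, b] = (b - a)%:E.
Proof. by move=> ab; rewrite lebesgue_measure_itv/= lte_fin ab EFinB. Qed.

Lemma integrable_cst_segment (R : realType) (a b r : R) :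
  (@lebesgue_measure R).-integrable `[a, b] (cst r%:E).
Proof.
apply: (@continuous_compact_integrable _ (cst r)); first exact: segment_compact.
by apply: continuous_subspaceT => ?; exact: cvg_cst.
Qed.

(** Supremum argument: let [c] be the supremum of the points [x] of the segment with [F a <= F x].
    The condition to the left of [c] puts [c] itself in that set, and the condition to its right
    would put a larger point there if [c < b]. *)
Lemma locally_nondecreasing_le (R : realType) (F : R -> R) (a b : R) :
  a <= b ->
  (forall t, a <= t <= b -> \forall s \near t,
     (t <= s <= b -> F t <= F s) /\ (a <= s <= t -> F s <= F t)) ->
  F a <= F b.
Proof.
move=> ab loc.
pose S := [set x | a <= x <= b /\ F a <= F x].
have Sa : S a by split; rewrite ?lexx.
have Sb : ubound S b by move=> x [/andP[]].
have ubS : has_ubound S by exists b.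
have supS : has_sup S by split; first exists a.
have ac : a <= sup S by exact: ub_le_sup.
have cb : sup S <= b by apply: ge_sup Sb; exists a.
set c := sup S in ac cb.
have [e /= e0 ball_e] := loc c (introT andP (conj ac cb)).
have FaFc : F a <= F c.
  have [s Ss cs] : exists2 s, S s & c - e < s.
    exact: sup_adherent e0 supS.
  have sc : s <= c by exact: ub_le_sup.
  case: Ss => /andP[as_ sb] Fs.
  have [|_ Fsc] := ball_e s; last by rewrite (le_trans Fs)// Fsc// as_.
  by rewrite /= ger0_norm ?subr_ge0// ltrBlDr -ltrBlDl.
have [->//|cb'] := eqVneq b c.
have {}cb : c < b by rewrite lt_neqAle eq_sym cb'.
pose s := Num.min b (c + e / 2).
have cs : c < s by rewrite lt_min cb ltrDl divr_gt0.
have sb : s <= b by rewrite ge_min lexx.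
suff /(ub_le_sup ubS) : S s by rewrite leNgt cs.
split; first by rewrite sb andbT (le_trans ac)// ltW.
have [|Fcs _] := ball_e s; last by rewrite (le_trans FaFc)// Fcs// sb ltW.
rewrite /= distrC gtr0_norm ?subr_gt0// ltrBlDl.
by rewrite gt_min ltrD2l ltr_pdivrMr// ltr_pMr// ltr1n orbT.
Qed.

(* A one-sided Vitali-Caratheodory theorem. With [c n] an enumeration of the
   rationals, [E n] the points of [`[a, b]] where [h] is [d]-close to [c n], and
   [V n] an open set barely larger than [E n], [K] is the sum of [h + 3 d] and
   of all the [|h| + |c n|] restricted to [V n `\` E n]. *)
Lemma lower_majorant (R : realType) (a b e : R) (h : R -> R) :
  a < b -> 0 < e ->
  (@lebesgue_measure R).-integrable `[a, b] (EFin \o h) ->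
  exists K : R -> \bar R,
  [/\ (@lebesgue_measure R).-integrable `[a, b] K,
      (\int[@lebesgue_measure R]_(t in `[a, b]) K t <=
        \int[@lebesgue_measure R]_(t in `[a, b]) (h t)%:E + e%:E)%E &
      forall t, a <= t <= b -> exists2 c, h t < c &
        \forall s \near t, a <= s <= b -> (c%:E <= K s)%E].
Proof.
move=> ab e0 inth.
set mu := @lebesgue_measure R.
have mab : measurable (`[a, b] : set (measurableTypeR R)).
  by exact: measurable_itv.
have icst := integrable_cst_segment a b.
have mh : measurable_fun `[a, b] h.
  by apply/measurable_EFinP; exact: measurable_int inth.
(* Chosen so that [3 * d * (b - a) + d = e]: the first summand is the integral of the shift [3 * d],
   the second bounds that of [psi]. *)
pose d := e / (3 * (b - a) + 1).
have den0 : 0 < 3 * (b - a) + 1 by rewrite ltr_wpDl// mulr_ge0// subr_ge0 ltW.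
have d0 : 0 < d by rewrite divr_gt0.
(* Integers that encode no rational get the harmless value 0; [pickle] reaches every rational. *)
pose c (n : nat) : R := ratr (odflt 0 (unpickle n : option rat)).
pose E n := `[a, b] `&` [set t | `|h t - c n| < d].
have mE n : measurable (E n).
  rewrite /E; have := measurableT_comp (@normr_measurable R setT)
    (measurable_funB mh (@measurable_cst _ _ _ _ `[a, b] (c n))).
  move=> /(_ ltac:(by []) `]-oo, d[ ltac:(by [])).
  by congr measurable; apply/seteqP; split => t /=; rewrite in_itv.
have Efin n : (mu (E n) < +oo)%E.
  apply: (@le_lt_trans _ _ (mu `[a, b])).
    apply: le_measure; last exact: subIsetl.
    - by rewrite inE; exact: mE.
    - by rewrite inE; exact: mab.
  by rewrite /mu lebesgue_measure_segment ?ltry.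
(* The cut-off to [[a, b]] makes [f n] integrable over the whole line, since [V n] may stick out of
   the segment. *)
pose f n : R -> R := (fun t => `|h t| + `|c n|) \_ `[a, b].
have f_ge0 n t : 0 <= f n t.
  by rewrite /f /patch; case: ifP => _; [exact: addr_ge0 | exact: lexx].
have intf n : mu.-integrable setT (EFin \o f n).
  rewrite -restrict_EFin; apply: (iffLR (integrable_mkcond _ mab)).
  have iabs := integrable_abse inth.
  have := integrableD mab iabs (icst `|c n|).
  exact: eq_integrable.
have mf n : measurable_fun setT (EFin \o f n) by exact: measurable_int (intf n).
(* Absolute continuity of the integral of [f n] gives a threshold [r], and outer regularity an open
   [V] whose excess over [E n] has measure below [r]. The bounds [d / 2 ^ n.+1] add up to [d]. *)
have /choice[V VE] n : exists V, [/\ open V, E n `<=` V &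
    (\int[mu]_(t in V `\` E n) (f n t)%:E <= (d / (2 ^ n.+1)%:R)%:E)%E].
  have p0 : 0 < d / (2 ^ n.+1)%:R by rewrite divr_gt0// ltr0n expn_gt0.
  have [r [r0 rP]] := integral_normr_continuous (intf n) p0.
  have [V [oV EV muV]] := lebesgue_regularity_outer (mE n) (Efin n) r0.
  exists V; split => //.
  have mVE : measurable (V `\` E n).
    by apply: measurableD => //; exact: open_measurable.
  have := rP _ mVE muV.
  under eq_Rintegral do rewrite ger0_norm//.
  rewrite -lte_fin /Rintegral fineK; first exact: ltW.
  by apply: integrable_fin_num => //; exact: integrableS (intf n).
have mV n : measurable (V n `\` E n).
  by apply: measurableD => //; apply: open_measurable; case: (VE n).
pose g n : R -> \bar R := (EFin \o f n) \_ (V n `\` E n).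
have g0 n t : (0 <= g n t)%E.
  by rewrite /g /patch; case: ifP => _ //=; rewrite lee_fin.
have mg n D : measurable D -> measurable_fun D (g n).
  move=> mD; apply/measurable_funTS.
  apply/(measurable_restrictT _ (mV n)).
  exact: measurable_funTS.
pose psi t := (\sum_(n <oo) g n t)%E.
have psi0 t : (0 <= psi t)%E by exact: nneseries_ge0.
have mpsi : measurable_fun `[a, b] psi.
  by apply: (@ge0_emeasurable_sum _ _ _ _ g xpredT) => // k _; exact: mg.
have int_psi : (\int[mu]_(t in `[a, b]) psi t <= d%:E)%E.
  rewrite /psi integral_nneseries//; last by move=> n; exact: mg.
  apply: (le_trans _ (epsilon_trick0 xpredT (ltW d0))).
  apply: lee_nneseries => [n _ _|n _]; first exact: integral_ge0.
  case: (VE n) => _ _; apply: le_trans.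
  rewrite /g -integral_mkcondr; apply: ge0_subset_integral => //.
  - exact: (measurableI _ _ mab (mV n)).
  - exact: mV.
  - exact: (measurable_funTS (mf n)).
  - by move=> t _; rewrite lee_fin.
have ipsi : mu.-integrable `[a, b] psi.
  apply/integrableP; split => //.
  under eq_integral do rewrite gee0_abs//.
  exact: (le_lt_trans int_psi (ltry _)).
have ihc := integrableD mab inth (icst (3 * d)).
exists ((EFin \o h) \+ cst (3 * d)%:E \+ psi)%E; split.
- exact: integrableD.
- rewrite (integralD mab ihc ipsi) (integralD mab inth (icst _)).
  have muab : mu `[a, b] = (b - a)%:E by exact: lebesgue_measure_segment.
  have -> : (\int[mu]_(t in `[a, b]) cst (3 * d)%:E t = (3 * d * (b - a))%:E)%E.
    by rewrite integral_cst// [RHS]EFinM -muab.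
  rewrite -addeA leeD2l//; apply: (le_trans (leeD2l _ int_psi)).
  rewrite -EFinD lee_fin; have -> : e = d * (3 * (b - a) + 1).
    by rewrite /d divfK// gt_eqF.
  by rewrite le_eqVlt; apply/orP; left; apply/eqP; ring.
move=> t tab.
(* Take a rational [c n] within [d] of [h t]: then [c n + d] exceeds [h t], and [V n] is a
   neighbourhood of [t] on whose trace in [[a, b]] the function [K] stays above [c n + d]. *)
have htd : h t - d < h t + d by rewrite ltrBlDr -addrA ltrDl; exact: addr_gt0.
have [q] := rat_in_itvoo htd.
have <- : c (pickle q) = ratr q by rewrite /c pickleK.
move: (pickle q) => {q} n; rewrite in_itv/= => /andP[qh hq].
have Et : E n t.
  by split=> //=; rewrite ltr_norml; apply/andP; split; lra.
exists (c n + d); first by lra.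
have [oV EV _] := VE n.
have /= Vt := open_nbhs_nbhs (conj oV (EV _ Et)).
near=> s => sab.
have Vs : V n s by near: s.
rewrite /= -EFinD.
have gs : (g n s <= psi s)%E.
  have := @nneseries_lim_ge R (fun k => g k s) xpredT 0 n.+1
    (fun k _ _ => g0 k s).
  apply: le_trans; rewrite big_nat_recr//= leeDr//.
  by apply: sume_ge0.
(* On [E n] the shift suffices, as [c n < h s + d]. Elsewhere in [V n] the term
   [g n s = |h s| + |c n|] compensates, as [h s + |h s| >= 0]. *)
have [Es|nEs] := pselect (E n s).
  case: Es => _ /=; rewrite ltr_norml => /andP[hs1 hs2].
  apply: (@le_trans _ _ (h s + 3 * d)%:E); first by rewrite lee_fin; lra.
  by rewrite leeDl.
apply: (le_trans _ (leeD2l _ gs)).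
rewrite /g patchE mem_set//= /f patchE mem_set//= -EFinD lee_fin.
have := ler_norm (c n); have := ler_norm (- h s); rewrite normrN; lra.
Unshelve. all: by end_near. Qed.

(** Let [J] be the indefinite integral of the majorant [K]. Near each [t] the slopes of [J] from [t]
    are at least some [c > h t], whereas those of [g] tend to [h t]; so [J - g] is locally
    nondecreasing, and [g b - g a <= J b], which exceeds the integral of [h] by at most [e]. *)
Lemma derivable_le_Rintegral (R : realType) (a b : R) (g h : R -> R) :
  a < b -> (forall x, a <= x <= b -> is_derive x 1 g (h x)) ->
  (@lebesgue_measure R).-integrable `[a, b] (EFin \o h) ->
  g b - g a <= \int[@lebesgue_measure R]_(t in `[a, b]) h t.
Proof.
move=> ab dg inth; apply/ler_addgt0Pr => e e0.
have [K [iK Ke KP]] := lower_majorant ab e0 inth.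
set mu := @lebesgue_measure R in iK Ke *.
pose J x := fine (\int[mu]_(t in `[a, x]) K t)%E.
have JD r s c : a <= r -> r <= s -> s <= b ->
    (forall u, r <= u <= s -> (c%:E <= K u)%E) -> c * (s - r) <= J s - J r.
  move=> ar rs sb cK.
  have mrs : measurable (`]r, s] : set (measurableTypeR R)).
    by exact: measurable_itv.
  have iK' (i : interval R) :
      [set` i] `<=` `[a, b] -> mu.-integrable [set` i] K.
    by move=> iab; apply: integrableS iK.
  have iar : mu.-integrable `[a, r] K.
    by apply: iK'; apply: subset_itvl; rewrite bnd_simp (le_trans rs).
  have irs : mu.-integrable `]r, s] K.
    by apply: iK'; apply: subset_itv; rewrite bnd_simp.
  have -> : J s = J r + fine (\int[mu]_(t in `]r, s]) K t)%E.
    rewrite /J (@itv_bndbnd_setU _ _ (BLeft a) (BRight r) (BRight s)) ?bnd_simp//.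
    rewrite integral_setU//.
    - by rewrite fineD//; exact: integrable_fin_num.
    - rewrite -itv_bndbnd_setU ?bnd_simp//; apply: (measurable_int mu).
      by apply: iK'; apply: subset_itvl; rewrite bnd_simp.
    - apply/disj_setPS => y [/=]; rewrite 2!in_itv/= => /andP[_ yr] /andP[].
      by rewrite ltNge yr.
  rewrite addrAC subrr add0r -lee_fin fineK; last exact: integrable_fin_num.
  have -> : (c * (s - r))%:E = (\int[mu]_(t in `]r, s]) cst c%:E t)%E.
    rewrite integral_cst//= EFinM; congr *%E.
    rewrite [RHS]lebesgue_measure_itv/= lte_fin.
    move: rs; rewrite le_eqVlt => /predU1P[->|->].
      by rewrite ltxx subrr.
    by rewrite EFinB.
  apply: (le_integral mrs _ irs).
  - apply: (integrableS _ mrs _ (integrable_cst_segment a b c)) => //.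
    by apply: subset_itv; rewrite bnd_simp.
  - move=> u; rewrite inE/= in_itv/= => /andP[ru us].
    by apply: cK; rewrite us ltW.
have : J a - g a <= J b - g b.
  apply: (@locally_nondecreasing_le _ (fun x => J x - g x)); first exact: ltW.
  move=> t tab; have [c htc near_t] := KP t tab.
  (* Caratheodory form of the derivative: [G s] is the slope of [g] between [t] and [s], continuous
     at [t] with value [h t < c]. *)
  have [G [gG cG Gt]] := iffLR (is_derive1_caratheodory _ _ _) (dg t tab).
  have near_G : \forall s \near t, G s < c.
    by apply: (cvgr_lt _ cG); rewrite Gt.
  have [d /= d0 dP] := filterI near_t near_G.
  near=> s.
  have st : `|t - s| < d by near: s; exists d.
  have [_ Gsc] := dP s st.
  have gst := gG s.
  move/andP : tab => [ta tb]; split => /andP[].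
  - move=> ts sb.
    have : c * (s - t) <= J s - J t.
      apply: JD => // u /andP[tu us]; apply: (dP u _).1.
        rewrite /=; apply: le_lt_trans st.
        by rewrite distrC (distrC t) !ger0_norm ?subr_ge0// lerD2r.
      by rewrite (le_trans ta)//= (le_trans us).
    have : G s * (s - t) <= c * (s - t) by rewrite ler_wpM2r ?subr_ge0// ltW.
    lra.
  - move=> as_ st'.
    have : c * (t - s) <= J t - J s.
      apply: JD => // u /andP[su ut]; apply: (dP u _).1.
        rewrite /=; apply: le_lt_trans st.
        by rewrite !ger0_norm ?subr_ge0// lerD2l lerN2.
      by rewrite (le_trans as_)//= (le_trans ut).
    have : G s * (t - s) <= c * (t - s) by rewrite ler_wpM2r ?subr_ge0// ltW.
    lra.
have -> : J a = 0 by rewrite /J set_itv1 integral_set1.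
have : J b <= \int[mu]_(t in `[a, b]) h t + e.
  rewrite -lee_fin /J /Rintegral EFinD !fineK//; exact: integrable_fin_num.
lra.
Unshelve. all: by end_near. Qed.

(** The preceding inequality, applied to both [g] and [- g]. *)
Lemma derivable_Rintegral (R : realType) (a b : R) (g h : R -> R) :
  a < b -> (forall x, a <= x <= b -> is_derive x 1 g (h x)) ->
  (@lebesgue_measure R).-integrable `[a, b] (EFin \o h) ->
  \int[@lebesgue_measure R]_(t in `[a, b]) h t = g b - g a.
Proof.
move=> ab dg inth; apply/eqP; rewrite eq_le; apply/andP; split; last first.
  exact: derivable_le_Rintegral.
have mab : measurable (`[a, b] : set (measurableTypeR R)).
  by exact: measurable_itv.
have ihN : (@lebesgue_measure R).-integrable `[a, b] (EFin \o (\- h)).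
  by have := integrableN inth; exact: eq_integrable.
have dgN x : a <= x <= b -> is_derive x 1 (\- g) ((\- h) x).
  by move=> xab; have := dg x xab => dgx; exact: is_deriveN.
have := derivable_le_Rintegral ab dgN ihN.
have -> : \int[@lebesgue_measure R]_(t in `[a, b]) (\- h) t =
    - \int[@lebesgue_measure R]_(t in `[a, b]) h t.
  rewrite -mulN1r -RintegralZl//.
  by apply: eq_Rintegral => t _ /=; rewrite mulN1r.
by rewrite /=; lra.
Qed.

(** One-sided limits stand in for the values of [g] at [a] and [b]. From the midpoint [c], the
    closed version expresses [g x] through the integral of [h] between [c] and [x], and this
    integral is continuous in [x] up to the endpoints. *)
Lemma derivable_oo_Rintegral (R : realType) (a b : R) (g h : R -> R) :
  a < b -> (forall x, a < x < b -> is_derive x 1 g (h x)) ->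
  (@lebesgue_measure R).-integrable `[a, b] (EFin \o h) ->
  exists la lb, [/\ g x @[x --> a^'+] --> la, g x @[x --> b^'-] --> lb &
    \int[@lebesgue_measure R]_(t in `[a, b]) h t = lb - la].
Proof.
move=> ab dg inth.
set mu := @lebesgue_measure R in inth *.
pose c := (a + b) / 2.
have ac : a < c by rewrite /c; lra.
have cb : c < b by rewrite /c; lra.
have iac : mu.-integrable `[a, c] (EFin \o h).
  apply: integrableS inth => //; apply: subset_itvl; exact: ltW.
have icb : mu.-integrable `[c, b] (EFin \o h).
  apply: integrableS inth => //; apply: subset_itvr; exact: ltW.
exists (g c - \int[mu]_(t in `[a, c]) h t), (g c + \int[mu]_(t in `[c, b]) h t).
have itvB x : a <= x -> x <= c -> \int[mu]_(t in `[a, c]) h t =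
    \int[mu]_(t in `[a, x]) h t + \int[mu]_(t in `[x, c]) h t.
  move=> ax xc; have := Rintegral_itvB iac.
  move=> /(_ x); rewrite !bnd_simp => /(_ ax xc).
  rewrite Rintegral_itv_obnd_cbnd => [<-|]; first by rewrite addrC subrK.
  by apply: integrableS iac => //; apply: subset_itvr; rewrite bnd_simp.
split.
- have /cvg_at_right_filter := parameterized_integral_cvg_left ac iac.
  rewrite /parameterized_integral => c0.
  rewrite -[X in _ --> X]addr0.
  suff : \forall x \near a^'+, g c - \int[mu]_(t in `[a, c]) h t +
     \int[mu]_(t in `[a, x]) h t = g x.
    move=> near_eq; apply: cvg_trans (cvgD (cvg_cst _) c0).
    exact: near_eq_cvg near_eq.
  near=> x.
  have ax : a < x by [].
  have xc : x < c by near: x; exact: nbhs_right_lt.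
  rewrite (itvB x) ?ltW//.
  have -> : \int[mu]_(t in `[x, c]) h t = g c - g x; last by ring.
  apply: derivable_Rintegral => //.
    by move=> y /andP[xy yc]; apply: dg; lra.
  by apply: integrableS iac => //; apply: subset_itvr; rewrite bnd_simp ltW.
- have c0 := parameterized_integral_cvg_at_left cb icb.
  rewrite /parameterized_integral in c0.
  suff : \forall x \near b^'-, g c + \int[mu]_(t in `[c, x]) h t = g x.
    move=> near_eq; apply: cvg_trans (cvgD (cvg_cst _) c0).
    exact: near_eq_cvg near_eq.
  near=> x.
  have xb : x < b by [].
  have cx : c < x by near: x; exact: nbhs_left_gt.
  have -> : \int[mu]_(t in `[c, x]) h t = g x - g c; last by ring.
  apply: derivable_Rintegral => //.
    by move=> y /andP[xy yc]; apply: dg; lra.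
  by apply: integrableS icb => //; apply: subset_itvl; rewrite bnd_simp ltW.
- have := Rintegral_itvB inth.
  move=> /(_ c); rewrite !bnd_simp => /(_ (ltW ac) (ltW cb)).
  rewrite Rintegral_itv_obnd_cbnd => [<-|]; first by ring.
  by apply: integrableS inth => //; apply: subset_itvr; rewrite bnd_simp ltW.
Unshelve. all: by end_near. Qed.

(** * Affine change of variables *)

Definition affine (R : realType) (u d t : R) : R := u + t * d.

Lemma measurable_affine (R : realType) (u d : R) :
  measurable_fun [set: measurableTypeR R] (affine u d : _ -> measurableTypeR R).
Proof. by apply: measurable_funD => //; exact: measurable_funM. Qed.

(** For nonzero [d] this is Lebesgue measure again. The absolute value allows for negative [d], the
    case of an endpoint to the right of [x]. *)
Definition scaled_pushforward (R : realType) (u d : R) :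
    {measure set (measurableTypeR R) -> \bar R} :=
  mscale (NngNum (normr_ge0 d))
    (measure_function_pushforward__canonical__measure_function_Measure
      (@lebesgue_measure R) (measurable_affine u d)).

(** By uniqueness of Lebesgue measure it suffices to compare on half-open intervals. For negative
    [d] the preimage of such an interval is closed on the other side, which leaves its length
    unchanged. *)
Lemma lebesgue_measure_affine (R : realType) (u d : R)
    (A : set (measurableTypeR R)) :
  d != 0 -> measurable A ->
  @lebesgue_measure R A = scaled_pushforward u d A.
Proof.
move=> d0.
move: A; apply: lebesgue_measure_unique => _ [[p q] _ <-].
rewrite /scaled_pushforward/= /mscale/= /pushforward.
have [dlt0|dgt0|d00] := ltgtP d 0; last by rewrite d00 eqxx in d0.
- have -> : affine u d @^-1` `]p, q] = `[(q - u) / d, (p - u) / d[%classic.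
    apply/seteqP; split => t /=; rewrite !in_itv/= /affine.
      by rewrite ler_ndivrMr// ltr_ndivlMr//; lra.
    by rewrite ler_ndivrMr// ltr_ndivlMr//; lra.
  rewrite !lebesgue_measure_itv/= !lte_fin.
  rewrite ltr_nM2r ?invr_lt0// ltrD2r.
  case: ifP => _; last by rewrite mule0.
  rewrite ltr0_norm// -!EFinB -EFinM; congr EFin; field.
  by rewrite lt_eqF.
- have -> : affine u d @^-1` `]p, q] = `](p - u) / d, (q - u) / d]%classic.
    apply/seteqP; split => t /=; rewrite !in_itv/= /affine.
      by rewrite ler_pdivlMr// ltr_pdivrMr//; lra.
    by rewrite ler_pdivlMr// ltr_pdivrMr//; lra.
  rewrite !lebesgue_measure_itv/= !lte_fin.
  rewrite ltr_pM2r ?invr_gt0// ltrD2r.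
  case: ifP => _; last by rewrite mule0.
  rewrite gtr0_norm// -!EFinB -EFinM; congr EFin; field.
  by rewrite gt_eqF.
Qed.

Lemma ge0_integral_affine (R : realType) (u d : R) (D : set R)
    (f : R -> \bar R) :
  d != 0 -> measurable D -> measurable_fun D f ->
  (forall x, D x -> (0 <= f x)%E) ->
  (\int[@lebesgue_measure R]_(x in D) f x =
   `|d|%:E *
     \int[@lebesgue_measure R]_(t in affine u d @^-1` D) f (affine u d t))%E.
Proof.
move=> d0 mD mf f0.
rewrite (eq_measure_integral (scaled_pushforward u d)); last first.
  by move=> A mA _; exact: lebesgue_measure_affine.
rewrite ge0_integral_mscale//.
congr (_ * _)%E.
apply: (ge0_integral_pushforward (measurable_affine u d)) => //.
by move=> x; rewrite inE; exact: f0.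
Qed.

Lemma integrable_affine (R : realType) (u d : R) (D : set R) (f : R -> R) :
  d != 0 -> measurable D ->
  (@lebesgue_measure R).-integrable D (EFin \o f) ->
  (@lebesgue_measure R).-integrable (affine u d @^-1` D)
    (EFin \o (f \o affine u d)).
Proof.
move=> d0 mD /integrableP[mf fy]; apply/integrableP; split.
  apply: (measurable_comp mD _ mf) => //; first by move=> _ [t Dt <-].
  exact: measurable_funTS (measurable_affine u d).
move: fy; rewrite (ge0_integral_affine u d0 mD)//; last exact: measurableT_comp.
apply: contraTT; rewrite !ltey !negbK => /eqP ->.
by rewrite gt0_muley ?eqxx// lte_fin normr_gt0.
Qed.

(** Reduces to the nonnegative case through positive and negative parts, whose integrals are
    finite. *)
Lemma Rintegral_affine (R : realType) (u d : R) (D : set R) (f : R -> R) :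
  d != 0 -> measurable D ->
  (@lebesgue_measure R).-integrable D (EFin \o f) ->
  \int[@lebesgue_measure R]_(x in D) f x =
   `|d| * \int[@lebesgue_measure R]_(t in affine u d @^-1` D) f (affine u d t).
Proof.
move=> d0 mD intf; have intg := integrable_affine u d0 mD intf.
have mf := measurable_int _ intf.
have mg := measurable_int _ intg.
have mpre : measurable (affine u d @^-1` D : set (measurableTypeR R)).
  by rewrite -[X in measurable X]setTI; exact: measurable_affine.
have pg := integrable_pos_fin_num mpre intg.
have ng := integrable_neg_fin_num mpre intg.
rewrite (funepos_comp (EFin \o f)) in pg.
rewrite (funeneg_comp (EFin \o f)) in ng.
have -> : \int[@lebesgue_measure R]_(x in D) f x =
    fine (\int[@lebesgue_measure R]_(x in D) (EFin \o f)^\+%E x -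
          \int[@lebesgue_measure R]_(x in D) (EFin \o f)^\-%E x)%E.
  by rewrite -integralE.
have -> : \int[@lebesgue_measure R]_(t in affine u d @^-1` D) f (affine u d t) =
    fine (\int[@lebesgue_measure R]_(t in affine u d @^-1` D)
            ((EFin \o f)^\+%E \o affine u d) t -
          \int[@lebesgue_measure R]_(t in affine u d @^-1` D)
            ((EFin \o f)^\-%E \o affine u d) t)%E.
  by rewrite -funepos_comp -funeneg_comp -integralE.
rewrite (ge0_integral_affine u d0 mD (measurable_funepos mf))//.
rewrite (ge0_integral_affine u d0 mD (measurable_funeneg mf))//.
rewrite (fineB pg ng) fineB ?fineM//; first by rewrite mulrBr.
- exact: fin_numM.
- exact: fin_numM.
Qed.

(** With [min] and [max] one statement serves both orientations: [u = a] to the left of [x], and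
    [u = m b] to its right. *)
Lemma preimage_affine (R : realType) (u x : R) : u != x ->
  affine u (x - u) @^-1` `[Num.min u x, Num.max u x] = `[0, 1]%classic.
Proof.
move=> ux; apply/seteqP; rewrite /affine.
have [{ux}ux|xu|uxE] := ltgtP u x; last 2 first.
- split => t /=; rewrite !in_itv/= => /andP[h1 h2]; apply/andP; split; nra.
- by rewrite uxE eqxx in ux.
split => t /=; rewrite !in_itv/= => /andP[h1 h2]; apply/andP; split; nra.
Qed.

Lemma affine_itvoo (R : realType) (u x t : R) : u != x -> 0 < t < 1 ->
  Num.min u x < affine u (x - u) t < Num.max u x.
Proof.
rewrite /affine; have [ux _|xu _|_] := ltgtP u x; last by [].
  by move=> /andP[h1 h2]; apply/andP; split; nra.
by move=> /andP[h1 h2]; apply/andP; split; nra.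
Qed.

Lemma is_derive_affine (R : realType) (u d t : R) :
  is_derive t 1 (affine u d) d.
Proof.
apply/is_derive1_caratheodory; exists (fun=> d); split => //; last exact: cvg_cst.
by move=> z; rewrite /affine; ring.
Qed.

Lemma is_derive1_cvg (R : realType) (f : R -> R) (x d : R) :
  is_derive x 1 f d -> f y @[y --> x] --> f x.
Proof.
by case=> df _; apply: differentiable_continuous; exact/derivable1_diffP.
Qed.

(** * The Gamma function *)

Lemma integrable_powRB1 (R : realType) (k : R) : 0 < k ->
  (@lebesgue_measure R).-integrable `[0, 1] (EFin \o (fun t => t `^ (k - 1))).
Proof.
move=> k0; set mu := @lebesgue_measure R.
pose p (t : R) := t `^ (k - 1).
have p_ge0 t : 0 <= p t by exact: powR_ge0.
have mp (D : set (measurableTypeR R)) : measurable_fun D (EFin \o p).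
  by apply/measurable_EFinP; apply: measurable_funTS; exact: measurable_powR.
apply/integrableP; split; first exact: mp.
have -> : (\int[mu]_(t in `[0%R, 1%R]) `|(p t)%:E|)%E =
    (\int[mu]_(t in `]0%R, 1%R]) (p t)%:E)%E.
  rewrite -integral_itv_obnd_cbnd;
    last by apply: measurableT_comp => //; exact: mp.
  by apply: eq_integral => t _ /=; rewrite ger0_norm.
(* Starting at [n.+2] keeps the left endpoint strictly below 1, so that no segment is degenerate. *)
pose F n : set (measurableTypeR R) := `[n.+2%:R^-1, 1]%classic.
have Fn n : 0 < (n.+2%:R^-1 : R) < 1.
  by rewrite invr_gt0 ltr0n/= invf_lt1 ?ltr1n ?ltr0n.
have FE : \bigcup_i F i = `]0, 1]%classic.
  apply/seteqP; split => t /=.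
    move=> [n _]; rewrite /F/= !in_itv/= => /andP[nt ->]; rewrite andbT.
    by apply: lt_le_trans nt; case/andP: (Fn n).
  rewrite in_itv/= => /andP[t0 t1].
  have [n] := ltr_add_invr t0; rewrite add0r => nt.
  exists n => //; rewrite /F/= in_itv/= t1 andbT (le_trans _ (ltW nt))//.
  by rewrite lef_pV2 ?posrE ?ltr0n// ler_nat.
have ndF : {homo F : n m / (n <= m)%N >-> (n <= m)%O}.
  move=> n m nm; rewrite subsetEset => t; rewrite /F/= !in_itv/= => /andP[nt ->].
  rewrite andbT; apply: le_trans nt.
  by rewrite lef_pV2 ?posrE ?ltr0n// ler_nat.
have mF n : measurable (F n) by exact: measurable_itv.
rewrite -FE.
have p0 (n : nat) t : F n t -> (0 <= (EFin \o p) t)%E.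
  by move=> _; rewrite lee_fin.
have cvgF := @ge0_nondecreasing_set_cvg_integral _ _ R F (EFin \o p) mu
  ndF mF (fun n => mp (F n)) p0.
apply: (@le_lt_trans _ _ k^-1%:E); last exact: ltry.
rewrite -(cvg_lim _ cvgF)//; apply: lime_le.
  by apply/cvg_ex; eexists; exact: cvgF.
apply: nearW => n /=.
have := Fn n; set e := n.+2%:R^-1 => /andP[e0 e1].
have dF (x : R) :
    0 < x -> is_derive x 1 (fun t : R => k^-1 * t `^ k) (x `^ (k - 1)).
  move=> x0; have d := is_derive1_powR k x0.
  have -> : x `^ (k - 1) = k^-1 *: (k * x `^ (k - 1)).
    by rewrite /GRing.scale/= mulrA mulVf ?mul1r// gt_eqF.
  exact: is_deriveZ.
have cF (x : R) : 0 < x -> {for x, continuous (fun t : R => k^-1 * t `^ k)}.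
  by move=> x0; exact: is_derive1_cvg (dF x x0).
rewrite (@continuous_FTC2 _ p (fun t => k^-1 * t `^ k))//.
- rewrite -EFinB lee_fin powR1 mulr1 gerBl mulr_ge0 ?powR_ge0// invr_ge0.
  exact: ltW.
- apply: derivable_within_continuous => x; rewrite in_itv/= => /andP[ex _].
  by apply: derivable_powR; rewrite in_itv/= andbT (lt_le_trans e0).
- split.
  + move=> x; rewrite in_itv/= => /andP[ex _]; apply: ex_derive; apply: dF.
    exact: lt_trans ex.
  + by apply: cvg_at_right_filter; exact: cF.
  + by apply: cvg_at_left_filter; exact: cF.
- move=> x; rewrite in_itv/= => /andP[ex _].
  by rewrite derive1E; apply: derive_val; apply: dF; exact: lt_trans ex.
Qed.

(** Raise [t / (2 * k) <= expR (t / (2 * k))] to the power [k]. Half of the exponential decay is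
    spent on the power, and the other half remains for integrability at infinity. *)
Lemma powR_expRN_le (R : realType) (k t : R) : 0 < k -> 0 <= t ->
  t `^ k * expR (- t) <= (2 * k) `^ k * expR (- (t / 2)).
Proof.
move=> k0 t0; have k20 : 0 < 2 * k by rewrite mulr_gt0.
have tk0 : 0 <= t / (2 * k) by rewrite divr_ge0// ltW.
have le_exp : (t / (2 * k)) `^ k <= expR (t / 2).
  have -> : t / 2 = t / (2 * k) * k by field; rewrite gt_eqF.
  rewrite expRM ge0_ler_powR ?nnegrE ?expR_ge0 ?(ltW k0)//.
  by apply: le_trans (expR_ge1Dx _); rewrite lerDr.
have -> : t `^ k = (2 * k) `^ k * (t / (2 * k)) `^ k.
  by rewrite -powRM ?(ltW k20)//; congr powR; field; rewrite gt_eqF.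
rewrite -mulrA ler_wpM2l ?powR_ge0//.
have -> : expR (- (t / 2)) = expR (t / 2) * expR (- t).
  by rewrite -expRD; congr expR; field.
by rewrite ler_wpM2r ?expR_ge0.
Qed.

Lemma integrable_expRN_half (R : realType) :
  (@lebesgue_measure R).-integrable `[0, +oo[
    (EFin \o (fun t : R => expR (- (t / 2)))).
Proof.
have dE (x : R) : is_derive x 1 (fun t : R => expR (- (t / 2)))
    (- (2^-1 * expR (- (x / 2)))).
  have -> : (fun t : R => expR (- (t / 2))) = expR \o affine 0 (- 2^-1).
    by apply/funext => t; rewrite /affine/=; congr expR; ring.
  have -> : - (2^-1 * expR (- (x / 2))) = expR (affine 0 (- 2^-1) x) * - 2^-1.
    by rewrite mulrN mulrC /affine; congr (- (expR _ * _)); ring.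
  exact: is_derive1_comp (is_derive_expR _) (is_derive_affine _ _ _).
pose f (t : R) := expR (- (t / 2)).
have cf : continuous f.
  by move=> x; exact: is_derive1_cvg (dE x).
have dF (x : R) : is_derive x 1 (fun t : R => - 2 * f t) (f x).
  have -> : f x = - 2 *: (- (2^-1 * f x)).
    by rewrite /GRing.scale/=; field.
  have dEx : is_derive x 1 f (- (2^-1 * f x)) by exact: dE.
  exact: is_deriveZ.
apply/integrableP; split.
  apply/measurable_EFinP; apply: measurable_funTS; exact: continuous_measurable_fun.
have -> : (\int[@lebesgue_measure R]_(t in `[0%R, +oo[) `|(f t)%:E|)%E =
   (\int[@lebesgue_measure R]_(t in `[0%R, +oo[) (f t)%:E)%E.
  by apply: eq_integral => t _ /=; rewrite ger0_norm// expR_ge0.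
rewrite (@ge0_continuous_FTC2y _ f (fun t => - 2 * f t) 0 0)//.
- by rewrite -EFinB ltry.
- by move=> x _; exact: expR_ge0.
- exact: continuous_subspaceT.
- rewrite -[X in _ --> X](mulr0 (- 2)); apply: cvgM; first exact: cvg_cst.
  have half : (t / 2 : R) @[t --> +oo] --> +oo.
    apply/cvgryPge => A; apply: filterS (nbhs_pinfty_ge (num_real (A * 2))).
    by move=> t; rewrite ler_pdivlMr.
  exact: cvg_comp half (@cvgr_expR R).
- apply: cvg_at_right_filter.
  by apply: cvgM; [exact: cvg_cst | exact: cf].
- by move=> x _; rewrite derive1E; apply: derive_val; exact: dF.
Qed.

(** Domination by the sum of [p] cut off to [[0, 1]], where [expR (- t) <= 1], and of the
    exponential bound above, which applies for [t > 1] because there [t]^ (k - 1) <= t [^ k]. *)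
Lemma integrable_Gamma (R : realType) (k : R) : 0 < k ->
  (@lebesgue_measure R).-integrable `]0, +oo[
    (EFin \o (fun t => t `^ (k - 1) * expR (- t))).
Proof.
move=> k0; set mu := @lebesgue_measure R.
pose p (t : R) := t `^ (k - 1).
have m0y : measurable (`]0, +oo[ : set (measurableTypeR R)).
  by exact: measurable_itv.
have m01 : measurable (`[0, 1] : set (measurableTypeR R)).
  by exact: measurable_itv.
have i1 : mu.-integrable `]0, +oo[ (EFin \o (p \_ `[0, 1])).
  rewrite -restrict_EFin.
  have := iffLR (integrable_mkcond _ m01) (integrable_powRB1 k0).
  exact: integrableS.
have i2 : mu.-integrable `]0, +oo[
    (EFin \o (fun t : R => (2 * k) `^ k * expR (- (t / 2)))).
  have m0 : measurable (`[0, +oo[ : set (measurableTypeR R)).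
    exact: measurable_itv.
  have i2' := integrableZl m0 ((2 * k) `^ k) (integrable_expRN_half R).
  by apply: (integrableS m0 m0y _ i2'); apply: subset_itvr; rewrite bnd_simp.
apply: (le_integrable m0y _ _ (integrableD m0y i1 i2)).
  apply/measurable_EFinP; apply: measurable_funTS.
  apply: measurable_funM; first exact: measurable_powR.
  by apply: measurableT_comp => //; exact: measurable_expR.
move=> t /=; rewrite in_itv/= andbT => t0.
rewrite lee_fin.
have e1 : expR (- t) <= 1 by rewrite expR_le1 oppr_le0 ltW.
have C0 : 0 <= (2 * k) `^ k * expR (- (t / 2)).
  by rewrite mulr_ge0 ?powR_ge0 ?expR_ge0.
rewrite ger0_norm ?mulr_ge0 ?powR_ge0 ?expR_ge0//.
rewrite patchE; case: ifPn => [t1|].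
  rewrite (le_trans _ (ler_norm _))// -[leLHS]addr0 lerD//.
  by rewrite ler_piMr// powR_ge0.
rewrite notin_setE/= in_itv/= ltW//= => /negP; rewrite -ltNge => t1.
rewrite /point/= add0r ger0_norm//.
apply: le_trans (powR_expRN_le k0 (ltW t0)).
by rewrite ler_wpM2r ?expR_ge0// ler_powR ?(ltW t1)// gerBl.
Qed.

(** Monotone convergence along []0, n.+1]], whose closure adds only a null set. *)
Lemma cvg_Gamma (R : realType) (k : R) : 0 < k ->
  \int[@lebesgue_measure R]_(t in `[0, n.+1%:R]) (t `^ (k - 1) * expR (- t))
    @[n --> \oo] --> Gamma k.
Proof.
move=> k0; have iG := integrable_Gamma k0.
set mu := @lebesgue_measure R in iG *.
set p := (fun t : R => _) in iG *.
pose F n : set (measurableTypeR R) := `]0, n.+1%:R]%classic.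
have FE : \bigcup_i F i = `]0, +oo[%classic.
  apply/seteqP; split => t /=.
    by move=> [n _]; rewrite /F/= !in_itv/= => /andP[-> _].
  rewrite in_itv/= andbT => t0; exists (Num.trunc t) => //.
  by rewrite /F/= in_itv/= t0 ltW// truncnS_gt.
have ndF : {homo F : n m / (n <= m)%N >-> (n <= m)%O}.
  move=> n m nm; rewrite subsetEset => t; rewrite /F/= !in_itv/= => /andP[-> tn].
  by rewrite (le_trans tn)// ler_nat.
have mF n : measurable (F n) by exact: measurable_itv.
have subF n : F n `<=` `]0, +oo[ by rewrite -FE; exact: bigcup_sup.
have iF n : mu.-integrable (F n) (EFin \o p).
  by apply: (integrableS _ (mF n) (subF n) iG); exact: measurable_itv.
have p0 (n : nat) t : F n t -> (0 <= (EFin \o p) t)%E.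
  by move=> _; rewrite lee_fin mulr_ge0 ?powR_ge0 ?expR_ge0.
have := @ge0_nondecreasing_set_cvg_integral _ _ R F (EFin \o p) mu
  ndF mF (fun n => measurable_int _ (iF n)) p0.
rewrite FE.
have -> : (\int[mu]_(x in `]0%R, +oo[) (EFin \o p) x)%E = (Gamma k)%:E.
  by rewrite /Gamma /Rintegral fineK//; exact: integrable_fin_num iG.
move=> /fine_cvg; apply: cvg_trans; apply: near_eq_cvg; apply: nearW => n /=.
by rewrite /Rintegral integral_itv_obnd_cbnd//; exact: measurable_int (iF n).
Qed.

(** Integration by parts: the derivative of [g] is [k * p k t - p (k + 1) t]. Integrate it over
    [[0, n.+1]]; as [g] vanishes at 0 and at infinity, letting [n] grow gives the functional
    equation. *)
Lemma GammaD1 (R : realType) (k : R) : 0 < k -> Gamma (k + 1) = k * Gamma k.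
Proof.
move=> k0; have k10 : 0 < k + 1 by rewrite addr_gt0.
set mu := @lebesgue_measure R.
pose p c (t : R) := t `^ (c - 1) * expR (- t).
pose g (t : R) := t `^ k * expR (- t).
have dN (t : R) : is_derive t 1 (fun t : R => expR (- t)) (- expR (- t)).
  have -> : (fun t : R => expR (- t)) = expR \o affine 0 (- 1).
    by apply/funext => x; rewrite /affine/= mulrN1 add0r.
  have -> : - expR (- t) = expR (affine 0 (- 1) t) * - 1.
    by rewrite /affine !mulrN1 add0r.
  exact: is_derive1_comp (is_derive_expR _) (is_derive_affine _ _ _).
have dg (t : R) : 0 < t -> is_derive t 1 g (k * p k t - p (k + 1) t).
  move=> t0; have dp := is_derive1_powR k t0.
  have -> : k * p k t - p (k + 1) t =
     t `^ k *: - expR (- t) + expR (- t) *: (k * t `^ (k - 1)).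
    by rewrite /GRing.scale/= /p addrK; ring.
  exact: is_deriveM.
have ip c n : 0 < c -> mu.-integrable `[0, n.+1%:R] (EFin \o p c).
  move=> c0.
  have m0n : measurable (`]0, n.+1%:R] : set (measurableTypeR R)).
    exact: measurable_itv.
  have mp (D : set (measurableTypeR R)) : measurable_fun D (EFin \o p c).
    apply/measurable_EFinP; apply: measurable_funTS.
    apply: measurable_funM; first exact: measurable_powR.
    by apply: measurableT_comp => //; exact: measurable_expR.
  have ioc : mu.-integrable `]0, n.+1%:R] (EFin \o p c).
    apply: (integrableS _ m0n _ (integrable_Gamma c0)); first exact: measurable_itv.
    by apply: subset_itvl; rewrite bnd_simp.
  apply/integrableP; split; first exact: mp.
  rewrite -integral_itv_obnd_cbnd;
    last by apply: measurableT_comp => //; exact: mp.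
  by case/integrableP : ioc.
have E n : k * \int[mu]_(t in `[0, n.+1%:R]) p k t -
    \int[mu]_(t in `[0, n.+1%:R]) p (k + 1) t = g n.+1%:R.
  have m0n : measurable (`[0, n.+1%:R] : set (measurableTypeR R)).
    exact: measurable_itv.
  have ik := integrableZl m0n k (ip k n k0).
  have ih := integrableB m0n ik (ip (k + 1) n k10).
  have n0 : 0 < n.+1%:R :> R by rewrite ltr0n.
  have dg' (t : R) :
      0 < t < n.+1%:R -> is_derive t 1 g (k * p k t - p (k + 1) t).
    by move=> /andP[t0 _]; exact: dg.
  have [la [lb [gla glb intE]]] := derivable_oo_Rintegral n0 dg' ih.
  rewrite -RintegralZl //; last exact: ip.
  rewrite -RintegralB //; last exact: ip.
  rewrite [LHS]intE.
  have -> : la = 0.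
    suff g0 : g x @[x --> 0^'+] --> 0 * expR (- 0).
      by rewrite mul0r in g0; exact: cvg_unique gla g0.
    apply: cvgM; first exact: powR_cvg0.
    apply: cvg_at_right_filter.
    exact: is_derive1_cvg (dN 0).
  have -> : lb = g n.+1%:R.
    suff gn : g x @[x --> n.+1%:R^'-] --> g n.+1%:R by exact: cvg_unique glb gn.
    by apply: cvg_at_left_filter; exact: is_derive1_cvg (dg _ n0).
  by rewrite subr0.
have g_cvg0 : g n.+1%:R @[n --> \oo] --> 0.
  have half : (n.+1%:R / 2 : R) @[n --> \oo] --> +oo.
    apply/cvgryPge => A;
    apply: filterS (nbhs_infty_ge (Num.trunc (A * 2))) => n An.
    rewrite ler_pdivlMr// (le_trans (ltW (truncnS_gt _)))// ler_nat ltnS.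
    exact: An.
  apply: (@squeeze_cvgr _ _ _ _ (cst 0)
    (fun n => (2 * k) `^ k * expR (- (n.+1%:R / 2)))).
  - apply: nearW => n; rewrite mulr_ge0 ?powR_ge0 ?expR_ge0//=.
    exact: powR_expRN_le.
  - exact: cvg_cst.
  - rewrite -[X in _ --> X](mulr0 ((2 * k) `^ k)).
    apply: cvgM; first exact: cvg_cst.
    exact: cvg_comp half (@cvgr_expR R).
have gE : g n.+1%:R @[n --> \oo] --> k * Gamma k - Gamma (k + 1).
  under eq_fun do rewrite -E.
  apply: cvgB; last exact: cvg_Gamma.
  by apply: cvgM; [exact: cvg_cst | exact: cvg_Gamma].
by apply/eqP; rewrite eq_sym -subr_eq0; apply/eqP; exact: cvg_unique gE g_cvg0.
Qed.

(** The integrand is bounded below by a positive constant on [[1, 2]]. Positivity allows cancelling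
    [Gamma k] in the final computation. *)
Lemma Gamma_gt0 (R : realType) (k : R) : 0 < k -> 0 < Gamma k.
Proof.
move=> k0; have iG := integrable_Gamma k0.
set mu := @lebesgue_measure R in iG *.
set p := (fun t : R => _) in iG *.
have m12 : measurable (`[1, 2] : set (measurableTypeR R)).
  by exact: measurable_itv.
have m0y : measurable (`]0, +oo[ : set (measurableTypeR R)).
  by exact: measurable_itv.
have p0 (t : R) : 0 <= p t by rewrite mulr_ge0 ?powR_ge0 ?expR_ge0.
have p12 (t : R) : 1 <= t <= 2 -> 2^-1 * expR (- 2) <= p t.
  move=> /andP[t1 t2]; rewrite ler_pM ?expR_ge0// ?invr_ge0//; last first.
    by rewrite ler_expR lerN2.
  (* Since [k - 1 > - 1] and [t >= 1], the power is at least [t^-1], hence at least [2^-1]. *)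
  apply: (@le_trans _ _ (t `^ (- 1)));
    last by rewrite ler_powR// lerBrDr addNr ltW.
  have t0 : 0 < t by exact: lt_le_trans t1.
  by rewrite powR_inv1 ?(ltW t0)// lef_pV2 ?posrE.
rewrite -lte_fin /Gamma /Rintegral fineK; last exact: integrable_fin_num iG.
apply: (@lt_le_trans _ _
  (\int[mu]_(t in `[1%R, 2%R]) (2^-1 * expR (- 2))%:E)%E).
  rewrite integral_cst// mule_gt0//.
  have lt12 : 1 < 2 :> R by rewrite ltr1n.
  rewrite [X in (_ < X)%E](lebesgue_measure_segment lt12) lte_fin; lra.
apply: (@le_trans _ _ (\int[mu]_(t in `[1%R, 2%R]) (p t)%:E)%E).
  apply: ge0_le_integral => //.
  apply: measurable_funS (measurable_int _ iG) => // t.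
  by rewrite /= !in_itv/= andbT => /andP[t1 _]; exact: lt_le_trans t1.
apply: ge0_subset_integral => //.
- exact: measurable_int iG.
- by move=> t _; rewrite lee_fin.
- by move=> t; rewrite /= !in_itv/= andbT => /andP[t1 _]; exact: lt_le_trans t1.
Qed.

(** * The identity at one endpoint *)

Lemma integrable_bounded_mul (R : realType) (D : set (measurableTypeR R))
    (h g : R -> R) (M : R) :
  measurable D -> measurable_fun D h -> (forall x, D x -> `|h x| <= M) ->
  (@lebesgue_measure R).-integrable D (EFin \o g) ->
  (@lebesgue_measure R).-integrable D (EFin \o (fun x => h x * g x)).
Proof.
move=> mD mh hM ig.
have bh : [bounded h x | x in D].
  exists M; split; first exact: num_real.
  by move=> N MN x Dx; exact: le_trans (hM x Dx) (ltW MN).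
exact: (integrableMr mD mh bh ig).
Qed.

Lemma segment_continuous_bounded (R : realType) (a b : R) (f : R -> R) :
  a <= b -> {within `[a, b], continuous f} ->
  exists M, forall x, a <= x <= b -> `|f x| <= M.
Proof.
move=> ab cf; have [c _ cM] := EVT_max ab cf; have [d _ dm] := EVT_min ab cf.
exists (Num.max `|f c| `|f d|) => x xab.
have xI : x \in `[a, b]%R by rewrite in_itv.
have := cM x xI; have := dm x xI; rewrite le_max => h1 h2.
have [f0|f0] := leP 0 (f x).
  by rewrite ger0_norm// (le_trans h2 (ler_norm _)).
rewrite (ltr0_norm f0); apply/orP; right.
by rewrite (@le_trans _ _ (- f d)) ?lerN2// -normrN ler_norm.
Qed.

Lemma integrable_powRB1_mul (R : realType) (phi : R -> R) (k : R) :
  0 < k -> {within `[0, 1], continuous phi} ->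
  (@lebesgue_measure R).-integrable `[0, 1]
    (EFin \o (fun t => t `^ (k - 1) * phi t)).
Proof.
move=> k0 cphi; have [M phiM] := segment_continuous_bounded ler01 cphi.
have m01 : measurable (`[0, 1] : set (measurableTypeR R)).
  by exact: measurable_itv.
have mphi := subspace_continuous_measurable_fun m01 cphi.
have phiM' (t : R) : `[0, 1]%classic t -> `|phi t| <= M.
  by rewrite /= in_itv; exact: phiM.
have := integrable_bounded_mul m01 mphi phiM' (integrable_powRB1 k0).
by apply: eq_integrable => // t _ /=; rewrite mulrC.
Qed.

Lemma integrable_weight_mul (R : realType) (g : R -> R) (k l : R) :
  0 < k -> (@lebesgue_measure R).-integrable `[0, 1] (EFin \o g) ->
  (@lebesgue_measure R).-integrable `[0, 1]
    (EFin \o (fun t => t * ((k + 1) * l - t `^ k) * g t)).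
Proof.
move=> k0 ig.
have m01 : measurable (`[0, 1] : set (measurableTypeR R)).
  by exact: measurable_itv.
apply: (@integrable_bounded_mul _ _ _ _ (`|(k + 1) * l| + 1)) => //.
- apply: measurable_funTS; apply: measurable_funM => //.
  by apply: measurable_funB => //; exact: measurable_powR.
- move=> t; rewrite /= in_itv/= => /andP[t0 t1].
  rewrite normrM (ger0_norm t0) -[leRHS]mul1r ler_pM//.
  rewrite (le_trans (ler_normB _ _))// lerD2l ger0_norm ?powR_ge0//.
  have : t `^ k <= 1 `^ k by rewrite ge0_ler_powR ?nnegrE// ltW.
  by rewrite powR1.
Qed.

(** Here [L] is the limit of [p1] at 1, which exists because [p2] is integrable. It is stated as the
    limit of a difference quotient of [phi], the form that compares with the derivative of [f] at
    [x]. *)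
Lemma weighted_integral_derive2 (R : realType) (phi p1 p2 : R -> R) (k l : R) :
  0 < k -> {within `[0, 1], continuous phi} ->
  (forall t : R, 0 < t < 1 -> is_derive t 1 phi (p1 t)) ->
  (forall t : R, 0 < t < 1 -> is_derive t 1 p1 (p2 t)) ->
  (@lebesgue_measure R).-integrable `[0, 1] (EFin \o p2) ->
  exists2 L, (phi t - phi 1) / (t - 1) @[t --> 1^'-] --> L &
    \int[@lebesgue_measure R]_(t in `[0, 1])
        (t * ((k + 1) * l - t `^ k) * p2 t) =
      ((k + 1) * l - 1) * L + (k + 1) * ((1 - l) * phi 1 + l * phi 0)
      - (k + 1) * k *
        \int[@lebesgue_measure R]_(t in `[0, 1]) (t `^ (k - 1) * phi t).
Proof.
move=> k0 cphi dphi dp1 ip2; set mu := @lebesgue_measure R in ip2 *.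
have m01 : measurable (`[0, 1] : set (measurableTypeR R)).
  by exact: measurable_itv.
have [_ phi0 phi1] := iffLR (continuous_within_itvP phi ltr01) cphi.
have [P0 [P1 [p1_0 p1_1 _]]] := derivable_oo_Rintegral ltr01 dp1 ip2.
exists P1.
  (* L'Hopital's rule converts the limit of [p1] into that of the difference quotient. *)
  apply: (@lhopital_at_left _ (fun t => phi t - phi 1) p1
    (fun t => t - 1) (fun=> 1) 0 1 P1).
  - exact: ltr01.
  - move=> t; rewrite in_itv/= => t01; have := dphi t t01 => dphit.
    by apply: is_derive_eq; rewrite subr0.
  - by move=> t _; apply: is_derive_eq; rewrite subr0.
  - by rewrite -(subrr (phi 1)); apply: cvgB => //; exact: cvg_cst.
  - rewrite -[X in _ --> X](subrr 1); apply: cvgB; last exact: cvg_cst.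
    exact: cvg_at_left_filter.
  - by move=> t _; exact: oner_neq0.
  - by under eq_fun do rewrite divr1.
pose w (t : R) := t * ((k + 1) * l - t `^ k).
pose q (t : R) := (k + 1) * (l - t `^ k).
(* As [q] is the derivative of [w], the terms in [p1] cancel in the derivative of [H]. *)
pose H (t : R) := w t * p1 t - q t * phi t.
have dH (t : R) : 0 < t < 1 ->
    is_derive t 1 H (w t * p2 t + (k + 1) * k * (t `^ (k - 1) * phi t)).
  move=> t01; have t0 : 0 < t by case/andP: t01.
  have dpk := is_derive1_powR k t0.
  have dphit := dphi t t01; have dp1t := dp1 t t01.
  have dw : is_derive t 1 w (q t).
    apply: is_derive_eq.
    rewrite /GRing.scale/= /q -(mulr_powRB1 (ltW t0) k0); ring.
  have dq : is_derive t 1 q (- ((k + 1) * (k * t `^ (k - 1)))).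
    apply: is_derive_eq.
    rewrite /GRing.scale/=; ring.
  apply: is_derive_eq; rewrite /GRing.scale/=; ring.
have iphi := integrable_powRB1_mul k0 cphi.
have iw := integrable_weight_mul l k0 ip2.
have iphi' := integrableZl m01 ((k + 1) * k) iphi.
have [la [lb [Hla Hlb HE]]] := derivable_oo_Rintegral ltr01 dH
  (integrableD m01 iw iphi').
(* At 0 the weight [w] vanishes while [p1] keeps a finite limit [P0], so only [q * phi]
   contributes. *)
have laE : la = - ((k + 1) * l * phi 0).
  suff H0 : H x @[x --> 0^'+] -->
      0 * ((k + 1) * l - 0) * P0 - (k + 1) * (l - 0) * phi 0.
    by rewrite (cvg_unique _ Hla H0)//; ring.
  have pk0 := powR_cvg0 k0.
  have id0 : (x : R) @[x --> 0^'+] --> (0 : R).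
    by apply: cvg_at_right_filter; exact: cvg_id.
  apply: cvgB; apply: cvgM => //; apply: cvgM => //; try exact: cvg_cst.
    by apply: cvgB => //; exact: cvg_cst.
  by apply: cvgB => //; exact: cvg_cst.
have lbE : lb = ((k + 1) * l - 1) * P1 - (k + 1) * (l - 1) * phi 1.
  suff H1 : H x @[x --> 1^'-] -->
      1 * ((k + 1) * l - 1 `^ k) * P1 - (k + 1) * (l - 1 `^ k) * phi 1.
    by rewrite (cvg_unique _ Hlb H1)// powR1; ring.
  have pk1 : x `^ k @[x --> (1 : R)^'-] --> 1 `^ k.
    by apply: cvg_at_left_filter; exact: is_derive1_cvg (is_derive1_powR k ltr01).
  have id1 : (x : R) @[x --> (1 : R)^'-] --> (1 : R).
    by apply: cvg_at_left_filter; exact: cvg_id.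
  apply: cvgB; apply: cvgM => //; apply: cvgM => //; try exact: cvg_cst.
    by apply: cvgB => //; exact: cvg_cst.
  by apply: cvgB => //; exact: cvg_cst.
rewrite laE lbE (RintegralD m01 iw iphi') (RintegralZl _ m01 iphi) in HE.
rewrite -[LHS]/(\int[mu]_(t in `[0, 1]) (w t * p2 t)).
apply: (addIr ((k + 1) * k *
  \int[mu]_(t in `[0, 1]) (t `^ (k - 1) * phi t))).
by rewrite [LHS]HE; ring.
Qed.

Lemma continuous_affine_comp (R : realType) (f : R -> R) (u x : R) : u != x ->
  {within `[Num.min u x, Num.max u x], continuous f} ->
  {within `[0, 1], continuous (f \o affine u (x - u))}.
Proof.
move=> ux /subspace_continuousP cf; apply/subspace_continuousP => t t01.
have St : `[Num.min u x, Num.max u x]%classic (affine u (x - u) t).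
  by move: t01; rewrite -(preimage_affine ux).
apply: cvg_comp (cf _ St) => A /= sA.
have nA : nbhs t (fun s => `[Num.min u x, Num.max u x]%classic
    (affine u (x - u) s) -> A (affine u (x - u) s)).
  exact: (is_derive1_cvg (is_derive_affine u (x - u) t)) sA.
change (nbhs t (fun s => `[0, 1]%classic s -> A (affine u (x - u) s))).
by apply: filterS nA => s As; rewrite -(preimage_affine ux).
Qed.

(** When all of [I] lies on the side of [x] where [u] is, approaching [x] inside [I] amounts to
    letting the parameter [t] of the segment from [u] to [x] increase to 1. The inverse affine map
    carries neighbourhoods back. *)
Lemma within_dnbhs_affine (R : realType) (I : set R) (u x : R) : u != x ->
  (forall t, 0 < t < 1 -> I (affine u (x - u) t)) ->
  (forall y, I y -> y != x -> 0 < (y - x) * (u - x)) ->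
  within I x^' = affine u (x - u) @ 1^'-.
Proof.
move=> ux Iseg Iside.
have d0 : x - u != 0 by rewrite subr_eq0 eq_sym.
have a1 : affine u (x - u) 1 = x by rewrite /affine; ring.
apply/seteqP; split => A.
  move=> wA.
  have cx : affine u (x - u) t @[t --> (1 : R)^'-] --> x.
    apply: cvg_at_left_filter; rewrite -{2}a1.
    exact: is_derive1_cvg (is_derive_affine u (x - u) 1).
  have near1 : \forall t \near (1 : R)^'-, affine u (x - u) t != x ->
      I (affine u (x - u) t) -> A (affine u (x - u) t) by exact: cx wA.
  change (\forall t \near (1 : R)^'-, A (affine u (x - u) t)).
  near=> t.
  have t1 : t < 1 by [].
  have t0 : 0 < t by near: t; exact: nbhs_left_gt.
  have At : affine u (x - u) t != x ->
      I (affine u (x - u) t) -> A (affine u (x - u) t).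
    by near: t; exact: near1.
  apply: At; last by apply: Iseg; rewrite t0.
  rewrite -subr_eq0 (_ : _ - x = (t - 1) * (x - u));
    last by rewrite /affine; ring.
  by rewrite mulf_neq0// subr_eq0 lt_eqF.
move=> A1.
have near1 : \forall t \near (1 : R), t < 1 -> A (affine u (x - u) t).
  by exact: A1.
have cx : affine (- u / (x - u)) (x - u)^-1 y @[y --> x] --> (1 : R).
  have e1 : affine (- u / (x - u)) (x - u)^-1 x = 1.
    by rewrite /affine -mulrDl addrC divff.
  by rewrite -e1; exact: is_derive1_cvg (is_derive_affine _ _ x).
have near_x : nbhs x (fun y => affine (- u / (x - u)) (x - u)^-1 y < 1 ->
    A (affine u (x - u) (affine (- u / (x - u)) (x - u)^-1 y))) by exact: cx near1.
change (nbhs x (fun y => y != x -> I y -> A y)).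
apply: filterS near_x => y Ay yx Iy.
have yE : affine u (x - u) (affine (- u / (x - u)) (x - u)^-1 y) = y.
  by rewrite /affine; field.
rewrite -yE; apply: Ay; rewrite -subr_lt0.
have -> : affine (- u / (x - u)) (x - u)^-1 y - 1 =
    - ((y - x) * (u - x) / (x - u) ^+ 2).
  by rewrite /affine; field.
by rewrite oppr_lt0 divr_gt0 ?Iside// exprn_even_gt0.
Unshelve. all: by end_near. Qed.

(** At an interior point this is the chain rule at [t = 1]. At an endpoint the equality of filters
    above turns the limit in [t] into the limit defining [derive1_in], up to the factor [x - u]. *)
Lemma derive1_in_affine (R : realType) (I : set R) (f : R -> R) (u x L : R) :
  u != x ->
  (forall t, 0 < t < 1 -> I (affine u (x - u) t)) ->
  (I° x /\ derivable f x 1) \/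
    (forall y, I y -> y != x -> 0 < (y - x) * (u - x)) ->
  (f (affine u (x - u) t) - f x) / (t - 1) @[t --> 1^'-] --> L ->
  L = (x - u) * derive1_in I f x.
Proof.
move=> ux Iseg Ix fL.
have d0 : x - u != 0 by rewrite subr_eq0 eq_sym.
have a1 : affine u (x - u) 1 = x by rewrite /affine; ring.
case: Ix => [[Ix dfx]|Iside].
  rewrite (derive1_inE Ix dfx).
  have df : is_derive (affine u (x - u) 1) 1 f (f^`() x).
    by rewrite a1; split => //; rewrite derive1E.
  have := is_derive1_comp df (is_derive_affine u (x - u) 1).
  move=> /is_derive1_caratheodory[G [gG cG G1]].
  rewrite mulrC -G1; apply: (cvg_unique _ fL) => //.
  apply: cvg_trans (cvg_at_left_filter cG).
  apply: near_eq_cvg; near=> t.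
  have t1 : t < 1 by [].
  by have /= := gG t; rewrite a1 => ->; rewrite mulfK// subr_eq0 lt_eqF.
rewrite /derive1_in (within_dnbhs_affine ux Iseg Iside).
have cq : (f (affine u (x - u) t) - f x) / (affine u (x - u) t - x)
    @[t --> 1^'-] --> L / (x - u).
  have near_eq : \forall t \near (1 : R)^'-,
      (f (affine u (x - u) t) - f x) / (t - 1) / (x - u) =
      (f (affine u (x - u) t) - f x) / (affine u (x - u) t - x).
    near=> t; have t1 : t < 1 by [].
    have -> : affine u (x - u) t - x = (t - 1) * (x - u) by rewrite /affine; ring.
    by rewrite invfM mulrA.
  exact: cvg_trans (near_eq_cvg near_eq) (cvgM fL (cvg_cst (x - u)^-1)).
by rewrite (cvg_lim _ cq)// mulrC divfK.
Unshelve. all: by end_near. Qed.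

Lemma one_sided_identity (R : realType) (I : set R) (f : R -> R) (u x k l : R) :
  let a := Num.min u x in let b := Num.max u x in
  0 < k -> u != x -> {within `[a, b], continuous f} ->
  (forall y, a < y < b -> [/\ I y, derivable f y 1 & derivable f^`() y 1]) ->
  (@lebesgue_measure R).-integrable `[a, b] (EFin \o f^`(2)%classic) ->
  (I° x /\ derivable f x 1) \/
    (forall y, I y -> y != x -> 0 < (y - x) * (u - x)) ->
  `|x - u| `^ (k + 2) / (k + 1) *
    \int[@lebesgue_measure R]_(t in `[0, 1])
      (t * ((k + 1) * l - t `^ k) * (f^`(2))%classic (affine u (x - u) t)) =
  (l - (k + 1)^-1) * `|x - u| `^ k * (x - u) * derive1_in I f x
  + `|x - u| `^ k * ((1 - l) * f x + l * f u)
  - k * \int[@lebesgue_measure R]_(t in `[a, b]) (`|t - u| `^ (k - 1) * f t).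
Proof.
move=> a b k0 ux cf df if2 Ix.
set mu := @lebesgue_measure R in if2 *.
set d := x - u; have d0 : d != 0 by rewrite subr_eq0 eq_sym.
have aff_oo (t : R) : 0 < t < 1 -> a < affine u d t < b by exact: affine_itvoo.
have mab : measurable (`[a, b] : set (measurableTypeR R)).
  by exact: measurable_itv.
have m01 : measurable (`[0, 1] : set (measurableTypeR R)).
  by exact: measurable_itv.
have ig : mu.-integrable `[0, 1] (EFin \o (f^`(2)%classic \o affine u d)).
  by have := integrable_affine u d0 mab if2; rewrite preimage_affine.
have ip2 : mu.-integrable `[0, 1]
    (EFin \o (fun t => d ^+ 2 * f^`(2)%classic (affine u d t))).
  by have := integrableZl m01 (d ^+ 2) ig; exact: eq_integrable.
have cphi := continuous_affine_comp ux cf.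
have dphi (t : R) : 0 < t < 1 ->
    is_derive t 1 (f \o affine u d) (d * f^`()%classic (affine u d t)).
  move=> /aff_oo /df[_ dfy _]; rewrite mulrC.
  apply: is_derive1_comp (is_derive_affine _ _ _).
  by split; [exact: dfy | rewrite derive1E].
have f2E : f^`(2)%classic = (f^`()^`())%classic by [].
have dp1 (t : R) : 0 < t < 1 ->
    is_derive t 1 (fun t => d * f^`()%classic (affine u d t))
      (d ^+ 2 * f^`(2)%classic (affine u d t)).
  move=> /aff_oo /df[_ _ dfy].
  have dd : is_derive t 1 (f^`() \o affine u d)
      (f^`(2)%classic (affine u d t) * d).
    apply: is_derive1_comp (is_derive_affine _ _ _).
    by split; [exact: dfy | rewrite f2E derive1E].
  have -> : d ^+ 2 * f^`(2)%classic (affine u d t) =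
      d *: (f^`(2)%classic (affine u d t) * d).
    by rewrite /GRing.scale/=; ring.
  exact: is_deriveZ.
have [L fL E] := weighted_integral_derive2 l k0 cphi dphi dp1 ip2.
have a1 : affine u d 1 = x by rewrite /affine /d; ring.
have a0 : affine u d 0 = u by rewrite /affine; ring.
rewrite /= a1 a0 in fL E.
have {fL}LE : L = d * derive1_in I f x.
  by apply: (derive1_in_affine ux _ Ix fL) => t /aff_oo /df[].
rewrite LE in E.
set W := \int[mu]_(t in _) _.
have WE : \int[mu]_(t in `[0, 1]) (t * ((k + 1) * l - t `^ k) *
    (d ^+ 2 * f^`(2)%classic (affine u d t))) = d ^+ 2 * W.
  rewrite -RintegralZl//; last exact: integrable_weight_mul.
  by apply: eq_Rintegral => t _; rewrite mulrCA.
have iphi := integrable_powRB1_mul k0 cphi.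
have d'0 : d^-1 != 0 by rewrite invr_eq0.
have affK y : affine u d (affine (- u / d) d^-1 y) = y by rewrite /affine; field.
have preE : affine (- u / d) d^-1 @^-1` `[0, 1] = `[a, b]%classic.
  by rewrite -(preimage_affine ux); apply/seteqP; split => y /=; rewrite affK.
pose J := \int[mu]_(t in `[0, 1]) (t `^ (k - 1) * f (affine u d t)).
(* Integrability is known on the [[0, 1]] side, so the change of variables uses the inverse affine
   map, of slope [d^-1]. *)
have KE : \int[mu]_(t in `[a, b]) (`|t - u| `^ (k - 1) * f t) = `|d| `^ k * J.
  have iG := integrable_affine (- u / d) d'0 m01 iphi; rewrite preE in iG.
  have JE := Rintegral_affine (- u / d) d'0 m01 iphi; rewrite preE in JE.
  rewrite /J [X in _ * X]JE -(mulr_powRB1 (normr_ge0 d) k0) normfV.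
  set G := (X in _ = _ * (_ * X)).
  have -> : `|d| * `|d| `^ (k - 1) * (`|d|^-1 * G) = `|d| `^ (k - 1) * G.
    by field; rewrite normr_eq0.
  rewrite /G -RintegralZl//; apply: eq_Rintegral => y.
  rewrite inE -preE /= in_itv/=.
  set s := affine _ _ y => /andP[s0 _].
  have -> : y - u = s * d by rewrite /s /affine; field.
  by rewrite normrM (ger0_norm s0) mulrC powRM// affK; ring.
rewrite KE.
have dk2 : `|d| `^ (k + 2) = `|d| `^ k * d ^+ 2.
  rewrite powRD; last by rewrite normr_eq0 d0 implybT.
  by rewrite powR_mulrn// real_normK// num_real.
rewrite dk2.
have k10 : k + 1 != 0 by rewrite gt_eqF// addr_gt0.
rewrite WE -/J in E.
have -> : `|d| `^ k * d ^+ 2 / (k + 1) * W =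
  `|d| `^ k / (k + 1) * (d ^+ 2 * W) by ring.
rewrite E; field.
exact: k10.
Qed.

(** * Points of an interval, and the identity with both endpoints *)

Lemma interval_interior (R : realType) (I : set R) (p q x : R) :
  is_interval I -> I p -> I q -> p < x < q -> I° x.
Proof.
move=> itvI Ip Iq pxq; apply: (@interiorS _ `]p, q[%classic).
  move=> y /=; rewrite in_itv/= => /andP[py yq].
  by apply: (itvI p q) => //; rewrite !ltW.
by rewrite interior_itv /= in_itv.
Qed.

(** A point [y] of [I] on the other side of [x] would place [x] strictly between [y] and [u], hence
    in the interior. *)
Lemma interval_endpoint_side (R : realType) (I : set R) (u x : R) :
  is_interval I -> I u -> u != x -> ~ I° x ->
  forall y, I y -> y != x -> 0 < (y - x) * (u - x).
Proof.
move=> itvI Iu ux nIx y Iy yx; rewrite ltNge; apply/negP => yux; apply: nIx.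
have [yltx|xlty|yx'] := ltgtP y x; last by rewrite yx' eqxx in yx.
- have xu : x < u.
    rewrite lt_neqAle eq_sym ux/= leNgt; apply/negP => ultx.
    by move: yux; rewrite leNgt nmulr_rgt0 ?subr_lt0// ultx.
  by apply: (interval_interior itvI Iy Iu); rewrite yltx.
- have xu : u < x.
    rewrite lt_neqAle ux/= leNgt; apply/negP => ultx.
    by move: yux; rewrite leNgt mulr_gt0 ?subr_gt0.
  by apply: (interval_interior itvI Iu Iy); rewrite xu.
Qed.

(* f_cont follows from f_diff2 except at a and m * b, and there too when they
   are interior to I; if a or b is an endpoint of I it cannot be dropped. *)
Theorem lemma1 (R : realType) (I : set R) (f : R -> R) (a b m : R)
  (I_itv : is_interval I)
  (f_diff2 : forall y : R, I° y -> derivable f y 1 /\ derivable f^`() y 1)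
  (Ia : I a) (Ib : I b)
  (m_gt0 : 0 < m) (m_le1 : m <= 1) (a_ge0 : 0 <= a) (a_lt_mb : a < m * b)
  (f_cont : {within `[a, m * b], continuous f})
  (f2_int : (@lebesgue_measure R).-integrable `[a, b] (EFin \o f^`(2))) :
  forall x l k : R, a <= x <= m * b -> 0 <= l <= 1 -> 0 < k ->
  I_fun I f x l k a (m * b) =
    (x - a) `^ (k + 2) / ((k + 1) * (m * b - a)) *
      \int[@lebesgue_measure R]_(t in `[0, 1])
        (t * ((k + 1) * l - t `^ k) * (f^`(2))%classic (t * x + (1 - t) * a))
    + (m * b - x) `^ (k + 2) / ((k + 1) * (m * b - a)) *
      \int[@lebesgue_measure R]_(t in `[0, 1])
        (t * ((k + 1) * l - t `^ k) * (f^`(2))%classic (t * x + m * (1 - t) * b)).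
Proof.
move=> x l k /andP[ax xc] _ k0; set mu := @lebesgue_measure R in f2_int *.
(* Positivity of [b] and [m <= 1] give [m * b <= b]: thus [m * b] is in [I], and the second
   derivative is integrable on [[a, m * b]]. *)
have b0 : 0 < b by rewrite -(pmulr_rgt0 _ m_gt0) (le_lt_trans a_ge0).
have cb : m * b <= b by rewrite ler_piMl// ltW.
set c := m * b in a_lt_mb f_cont xc cb *.
have Ic : I c by apply: (I_itv a b) => //; rewrite ltW.
pose W u := \int[mu]_(t in `[0, 1])
  (t * ((k + 1) * l - t `^ k) * (f^`(2))%classic (affine u (x - u) t)).
pose K u := \int[mu]_(t in `[Num.min u x, Num.max u x])
  (`|t - u| `^ (k - 1) * f t).
have side u : I u -> a <= u <= c ->
    `|x - u| `^ (k + 2) / (k + 1) * W u =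
    (l - (k + 1)^-1) * `|x - u| `^ k * (x - u) * derive1_in I f x
    + `|x - u| `^ k * ((1 - l) * f x + l * f u) - k * K u.
  move=> Iu /andP[au uc].
  (* If [x] is the endpoint itself, both sides are 0: the powers of 0 have positive exponents and
     [K] integrates over a point. *)
  have [->|ux] := eqVneq u x.
    rewrite subrr normr0 !powR0 ?gt_eqF ?addr_gt0// /K minxx maxxx.
    by rewrite set_itv1 Rintegral_set1 !(mul0r, mulr0) subr0 addr0.
  have sub_ac : `[Num.min u x, Num.max u x] `<=` `[a, c].
    by apply: subset_itv; rewrite bnd_simp ?le_min ?ge_max ?au ?uc.
  apply: (one_sided_identity _ k0 ux).
  - exact: continuous_subspaceW sub_ac f_cont.
  - move=> y /andP[]; rewrite gt_min lt_max => uxy yux.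
    have acy : a < y < c.
      apply/andP; split.
        by case/orP: uxy; apply: le_lt_trans.
      by case/orP: yux => /lt_le_trans; apply.
    have [|dfy df'y] := f_diff2 y; first exact: interval_interior acy.
    split => //; apply: (I_itv a c) => //.
    by case/andP: acy => /ltW -> /ltW ->.
  - apply: integrableS f2_int => //.
    apply: (subset_trans sub_ac); by apply: subset_itvl; rewrite bnd_simp.
  - have [Ix|nIx] := pselect (I° x).
      by left; split => //; case: (f_diff2 x Ix).
    by right; exact: interval_endpoint_side.
have KaE : RL_minus k f x a = (Gamma k)^-1 * K a.
  rewrite /RL_minus /K (min_idPl ax) (max_idPr ax); congr *%R.
  apply: eq_Rintegral => t; rewrite inE/= in_itv/= => /andP[at_ _].
  rewrite -subr_ge0 in at_; rewrite (ger0_norm at_); reflexivity.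
have KcE : RL_plus k f x c = (Gamma k)^-1 * K c.
  rewrite /RL_plus /K (min_idPr xc) (max_idPl xc); congr *%R.
  apply: eq_Rintegral => t; rewrite inE/= in_itv/= => /andP[_ tc].
  rewrite -subr_ge0 in tc; rewrite distrC (ger0_norm tc); reflexivity.
have WaE : \int[mu]_(t in `[0, 1]) (t * ((k + 1) * l - t `^ k) *
    (f^`(2))%classic (t * x + (1 - t) * a)) = W a.
  apply: eq_Rintegral => t _.
  have -> : t * x + (1 - t) * a = affine a (x - a) t by rewrite /affine; ring.
  reflexivity.
have WcE : \int[mu]_(t in `[0, 1]) (t * ((k + 1) * l - t `^ k) *
    (f^`(2))%classic (t * x + m * (1 - t) * b)) = W c.
  apply: eq_Rintegral => t _.
  have -> : t * x + m * (1 - t) * b = affine c (x - c) t.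
    by rewrite /affine /c; ring.
  reflexivity.
have := side a Ia; rewrite lexx (ltW a_lt_mb) => /(_ isT) Sa.
have := side c Ic; rewrite lexx (ltW a_lt_mb) => /(_ isT) Sc.
rewrite [X in _ = _ * X + _]WaE [X in _ = _ + _ * X]WcE.
(* The factor [Gamma (k + 1)] against [(Gamma k)^-1] leaves the [k] in front of [K]. *)
rewrite /I_fun KaE KcE (GammaD1 k0).
(* From here on the integrals are opaque atoms and the goal is an identity of rational
   expressions. *)
clear KaE KcE WaE WcE side; clearbody W K.
have powRS (y : R) : 0 <= y -> y `^ (k + 1) = y `^ k * y.
  by move=> y0; rewrite -{2}(addrK 1 k) mulrC mulr_powRB1 ?addr_gt0.
have xa0 : 0 <= x - a by rewrite subr_ge0.
have cx0 : 0 <= c - x by rewrite subr_ge0.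
rewrite (ger0_norm xa0) in Sa; rewrite distrC (ger0_norm cx0) in Sc.
rewrite (powRS _ xa0) (powRS _ cx0).
have G0 : Gamma k != 0 by rewrite gt_eqF// Gamma_gt0.
have k10 : k + 1 != 0 by rewrite gt_eqF// addr_gt0.
have ca : c - a != 0 by rewrite gt_eqF// subr_gt0.
have -> : (x - a) `^ (k + 2) / ((k + 1) * (c - a)) * W a =
  (x - a) `^ (k + 2) / (k + 1) * W a / (c - a) by field; rewrite ca k10.
have -> : (c - x) `^ (k + 2) / ((k + 1) * (c - a)) * W c =
  (c - x) `^ (k + 2) / (k + 1) * W c / (c - a) by field; rewrite ca k10.
rewrite Sa Sc; field.
by rewrite G0 k10 ca.
Qed.
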